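(* If an $R_3$-like Finsler manifold $(M,L)$ is of $p$-scalar curvature, then it is of $s$-$ps$ curvature.
   Context: Setting. $M$ is a smooth manifold of finite dimension $n$, $\pi:\mathcal{T}M\to M$ is the bundle of nonzero tangent vectors, $\pi^{-1}(TM)\to\mathcal{T}M$ is the pullback of $TM$ by $\pi$, and $\mathfrak{X}(\pi(M))$ is the module of its smooth sections ($\pi$-vector fields, written $\overline{X}$). $\overline{\eta}(u)=(u,u)$ is the fundamental $\pi$-vector field. $\rho:T(\mathcal{T}M)\to\pi^{-1}(TM)$ is $\rho=(\pi_{\mathcal{T}M},d\pi)$ and $\gamma:\pi^{-1}(TM)\to V(\mathcal{T}M)$ is the natural isomorphism (vertical lift) onto the vertical bundle. $(M,L)$ is a Finsler manifold ($L$ positively homogeneous of degree $1$, smooth on $\mathcal{T}M$, with positive definite metric $g$ on $\pi^{-1}(TM)$ of components $g_{ij}=\frac12\partial^2L^2/\partial y^i\partial y^j$). Put $\ell(\overline{X})=L^{-1}g(\overline{X},\overline{\eta})$, $\hbar=g-\ell\otimes\ell$ and $\phi(\overline{X})=\overline{X}-L^{-1}\ell(\overline{X})\overline{\eta}$. A linear connection $\nabla$ in $\pi^{-1}(TM)$ is regular if, with $K(X)=\nabla_X\overline{\eta}$ and $H(\mathcal{T}M)=\ker K$, one has $T(\mathcal{T}M)=V(\mathcal{T}M)\oplus H(\mathcal{T}M)$; then $\beta=(\rho|_{H(\mathcal{T}M)})^{-1}$. Its torsion is $\mathbf{T}(X,Y)=\nabla_X\rho Y-\nabla_Y\rho X-\rho[X,Y]$;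 put $Q(\overline{X},\overline{Y})=\mathbf{T}(\beta\overline{X},\beta\overline{Y})$ and $T(\overline{X},\overline{Y})=\mathbf{T}(\gamma\overline{X},\beta\overline{Y})$. Throughout, $\nabla$ is the Cartan connection: the unique regular connection with $\nabla g=0$, $Q=0$ and $g(T(\overline{X},\overline{Y}),\overline{Z})=g(T(\overline{X},\overline{Z}),\overline{Y})$. Its classical curvature is $\mathbf{K}(X,Y)\rho Z=-\nabla_X\nabla_Y\rho Z+\nabla_Y\nabla_X\rho Z+\nabla_{[X,Y]}\rho Z$ and its $h$-curvature tensor is $R(\overline{X},\overline{Y})\overline{Z}=\mathbf{K}(\beta\overline{X},\beta\overline{Y})\overline{Z}$, with $R(\overline{X},\overline{Y},\overline{Z},\overline{W})=g(R(\overline{X},\overline{Y})\overline{Z},\overline{W})$. Put $Ric^h(\overline{X},\overline{Y})=\mathrm{Tr}\{\overline{Z}\mapsto R(\overline{X},\overline{Z})\overline{Y}\}$, $g(Ric^h_0(\overline{X}),\overline{Y})=Ric^h(\overline{X},\overline{Y})$, $Sc^h=\mathrm{Tr}(Ric^h_0)$, and $F=\frac{1}{n-2}\{Ric^h-\frac{Sc^h\,g}{2(n-1)}\}$. Definitions. $(M,L)$ is: - $R_3$-like if $\dim M\ge4$ and $R(\overline{X},\overline{Y},\overline{Z},\overline{W})=g(\overline{X},\overline{Z})F(\overline{Y},\overline{W})-g(\overline{Y},\overline{Z})F(\overline{X},\overline{W})+g(\overline{Y},\overline{W})F(\overline{X},\overline{Z})-g(\overline{X},\overline{W})F(\overline{Y},\overline{Z})$;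 - of scalar curvature ($\dim M\geq 3$) if $R(\overline{\eta},\overline{X},\overline{\eta},\overline{Y})=kL^2\hbar(\overline{X},\overline{Y})$ for some scalar function $k:\mathcal{T}M\to\mathbb{R}$; - of $p$-scalar (perpendicular scalar) curvature if there is a function $R_o$ with $R(\phi(\overline{X}),\phi(\overline{Y}),\phi(\overline{Z}),\phi(\overline{W}))=R_o\{\hbar(\overline{X},\overline{Z})\hbar(\overline{Y},\overline{W})-\hbar(\overline{X},\overline{W})\hbar(\overline{Y},\overline{Z})\}$; - of $s$-$ps$ curvature if it is both of scalar curvature and of $p$-scalar curvature. *)

(* Defs.v *)
From HB Require Import structures.
From mathcomp Require Import all_boot all_order all_algebra.
From mathcomp Require Import all_classical all_reals all_analysis.

Set Implicit Arguments.
Unset Strict Implicit.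
Unset Printing Implicit Defensive.

Import Order.TTheory GRing.Theory Num.Theory.
Import numFieldNormedType.Exports.

Local Open Scope classical_set_scope.
Local Open Scope ring_scope.

(* A tangent vector is stored by its components in a preferred chart at its
   base point, so that every tangent space of an n-manifold is 'rV[R]_n.
   Fields are total functions.  The slit bundle consists of the u with
   vec u != 0, and only the values there are ever constrained.  pi-vector
   fields, vector fields and functions are local: a tensor identity is
   required, at each point u of the slit bundle, for all fields defined and
   smooth on some neighbourhood of u. *)

Section Smooth.
Context {R : realType} {V W : normedModType R}.

Fixpoint Ck (k : nat) (O : set V) (f : V -> W) : Prop :=
  match k with
  | 0 => forall x, O x -> {for x, continuous f}
  | k'.+1 => (forall x, O x -> differentiable f x) /\
             (forall v, Ck k' O (fun x => 'd f x v))
  end.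

Definition smooth_on (O : set V) (f : V -> W) := forall k, Ck k O f.

Definition smooth_near (x : V) (f : V -> W) :=
  exists2 O, open_nbhs x O & smooth_on O f.

End Smooth.

(* [coordI c] is the inverse of the chart [coord c] on its image. *)
Record smoothManifold (R : realType) (n : nat) := SmoothManifold {
  carrier :> topologicalType ;
  chart : Type ;
  dom : chart -> set carrier ;
  coord : chart -> carrier -> 'rV[R]_n ;
  coordI : chart -> 'rV[R]_n -> carrier ;
  chart_at : carrier -> chart ;
  manifold_hausdorff : hausdorff_space carrier ;
  manifold_second_countable : @second_countable carrier ;
  dom_open : forall c, open (dom c) ;
  dom_chart_at : forall p, dom (chart_at p) p ;
  image_open : forall c, open (coord c @` dom c) ;
  coordK : forall c p, dom c p -> coordI c (coord c p) = p ;
  coord_continuous : forall c p, dom c p -> {for p, continuous (coord c)} ;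
  coordI_continuous : forall c p, dom c p ->
    {for coord c p, continuous (coordI c)} ;
  transition_smooth : forall c d,
    smooth_on (coord c @` (dom c `&` dom d)) (coord d \o coordI c)
}.

(* [vec u] : components of the tangent vector in [chart_at (base u)]. *)
Record tangent (R : realType) (n : nat) (M : smoothManifold R n) := Tangent {
  base : M ;
  vec : 'rV[R]_n
}.

Section TangentBundle.
Context {R : realType} {n : nat} {M : smoothManifold R n}.
Local Notation TM := (tangent M).
Implicit Types (p : M) (u : TM).

Definition slit u : Prop := vec u != 0.

(* The components in the chart c of the vector of T_p M whose components in
   the preferred chart are v; [comp_back] is the inverse operation. *)
Definition comp (c : chart M) p (v : 'rV[R]_n) : 'rV[R]_n :=
  'd (coord c \o coordI (chart_at p)) (coord (chart_at p) p) v.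

Definition comp_back (c : chart M) p (v : 'rV[R]_n) : 'rV[R]_n :=
  'd (coord (chart_at p) \o coordI c) (coord c p) v.

(* The chart (x, y) of TM induced by the chart c, and its inverse. *)
Definition tcoord (c : chart M) u : 'rV[R]_n * 'rV[R]_n :=
  (coord c (base u), comp c (base u) (vec u)).

Definition tcoordI (c : chart M) (z : 'rV[R]_n * 'rV[R]_n) : TM :=
  Tangent (coordI c z.1) (comp_back c (coordI c z.1) z.2).

Definition tchart_at u : chart M := chart_at (base u).

(* T_u(TM) is 'rV_n * 'rV_n through tcoord (tchart_at u). *)
Definition tvector : Type := ('rV[R]_n * 'rV[R]_n)%type.

Definition pifield : Type := TM -> 'rV[R]_n.
Definition vfield : Type := TM -> 'rV[R]_n * 'rV[R]_n.

(* dF_u(v) *)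
Definition tdiff {W : normedModType R} (F : TM -> W) u
    (v : 'rV[R]_n * 'rV[R]_n) : W :=
  'd (F \o tcoordI (tchart_at u)) (tcoord (tchart_at u) u) v.

Definition smooth_fun u (F : TM -> R) :=
  smooth_near (tcoord (tchart_at u) u) (F \o tcoordI (tchart_at u)).

Definition smooth_pifield u (Z : pifield) :=
  smooth_near (tcoord (tchart_at u) u)
    ((fun u' => comp (tchart_at u) (base u') (Z u')) \o tcoordI (tchart_at u)).

Definition smooth_vfield u (X : vfield) :=
  smooth_near (tcoord (tchart_at u) u)
    ((fun u' => tdiff (tcoord (tchart_at u)) u' (X u'))
       \o tcoordI (tchart_at u)).

Definition bracket (X Y : vfield) : vfield := fun u =>
  tdiff (fun u' => tdiff (tcoord (tchart_at u)) u' (Y u')) u (X u) -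
  tdiff (fun u' => tdiff (tcoord (tchart_at u)) u' (X u')) u (Y u).

Definition eta : pifield := fun u => vec u.

(* rho(d/dx^i) = d_i and rho(d/dy^i) = 0, while gamma(d_i) = d/dy^i. *)
Definition rho (X : vfield) : pifield := fun u => (X u).1.
Definition gamma (Z : pifield) : vfield := fun u => (0, Z u).

(* The i-th coordinate field of the preferred chart at u, near u. *)
Definition frame u (i : 'I_n) : pifield := fun u' =>
  comp_back (tchart_at u) (base u') (delta_mx 0 i).

(* Trace at u of a linear endomorphism A of the module of pi-vector fields,
   in the coordinate frame at u. *)
Definition trace (A : pifield -> pifield) u : R :=
  \sum_(i < n) A (frame u i) u 0 i.

End TangentBundle.

Section Finsler.
Context {R : realType} {n : nat} {M : smoothManifold R n}.
Local Notation TM := (tangent M).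
Context (L : TM -> R).
Implicit Types (u : TM) (X Y Z W : @pifield R n M).

Definition g_comp u : 'M[R]_n := \matrix_(i, j)
  (2^-1 * 'D_(0, delta_mx 0 i)
    ('D_(0, delta_mx 0 j) (fun z => L (tcoordI (tchart_at u) z) ^+ 2))
    (tcoord (tchart_at u) u)).

Definition metric u (x y : 'rV[R]_n) : R := (x *m g_comp u *m y^T) 0 0.

Definition g X Y : TM -> R := fun u => metric u (X u) (Y u).

Definition finsler : Prop :=
  [/\ forall u (t : R), slit u -> 0 < t ->
        L (Tangent (base u) (t *: vec u)) = t * L u,
      forall u, slit u -> smooth_fun u L,
      forall u x y, slit u -> metric u x y = metric u y x &
      forall u x, slit u -> x != 0 -> 0 < metric u x x].

Definition ell X : TM -> R := fun u => (L u)^-1 * g X eta u.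

Definition hbar X Y : TM -> R := fun u => g X Y u - ell X u * ell Y u.

Definition phi X : @pifield R n M := fun u =>
  X u - ((L u)^-1 * ell X u) *: eta u.

End Finsler.

Section Connection.
Context {R : realType} {n : nat} {M : smoothManifold R n}.
Local Notation TM := (tangent M).
Local Notation pifield := (@pifield R n M).
Local Notation vfield := (@vfield R n M).
Local Notation tvector := (@tvector R n).
Implicit Types (u : TM).

(* [nabla u v Z] is the derivative at u of the field Z in the direction v of
   T_u(TM). *)
Context (nabla : TM -> tvector -> pifield -> 'rV[R]_n).

Definition cov (X : vfield) (Z : pifield) : pifield := fun u =>
  nabla u (X u) Z.

Definition linear_connection : Prop :=
  [/\ forall u Z (a : R) (v w : tvector), slit u -> smooth_pifield u Z ->
        nabla u (a *: v + w) Z = a *: nabla u v Z + nabla u w Z,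
      forall u v Z W, slit u -> smooth_pifield u Z -> smooth_pifield u W ->
        nabla u v (fun u' => Z u' + W u') = nabla u v Z + nabla u v W,
      forall u v (f : TM -> R) Z,
        slit u -> smooth_fun u f -> smooth_pifield u Z ->
        nabla u v (fun u' => f u' *: Z u') =
          tdiff f u v *: Z u + f u *: nabla u v Z &
      forall u X Z, slit u -> smooth_vfield u X -> smooth_pifield u Z ->
        smooth_pifield u (cov X Z)].

Definition vertical u : set tvector := [set v | v.1 = 0].

Definition horizontal u : set tvector := [set v | nabla u v eta = 0].

Definition regular : Prop := forall u, slit u ->
  (forall v, exists w h, [/\ vertical u w, horizontal u h & v = w + h]) /\
  vertical u `&` horizontal u = [set 0].

Definition beta (Z : pifield) : vfield := fun u =>
  xget 0 [set h | horizontal u h /\ h.1 = Z u].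

Definition torsion (X Y : vfield) : pifield := fun u =>
  cov X (rho Y) u - cov Y (rho X) u - rho (bracket X Y) u.

Definition Qtorsion (X Y : pifield) : pifield := torsion (beta X) (beta Y).

Definition Ttorsion (X Y : pifield) : pifield := torsion (gamma X) (beta Y).

Definition curvature (X Y : vfield) (Z : pifield) : pifield := fun u =>
  - cov X (cov Y Z) u + cov Y (cov X Z) u + cov (bracket X Y) Z u.

Definition hcurv (X Y Z : pifield) : pifield :=
  curvature (beta X) (beta Y) Z.

Definition Ric (X Y : pifield) : TM -> R := trace (fun Z => hcurv X Z Y).

End Connection.

Section CartanConnection.
Context {R : realType} {n : nat} {M : smoothManifold R n}.
Local Notation TM := (tangent M).
Local Notation pifield := (@pifield R n M).
Local Notation tvector := (@tvector R n).
Context (L : TM -> R) (nabla : TM -> tvector -> pifield -> 'rV[R]_n).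
Implicit Types (u : TM) (X Y Z W : pifield).

Definition cartan_connection : Prop :=
  [/\ linear_connection nabla,
      regular nabla,
      forall u v X Y, slit u -> smooth_pifield u X -> smooth_pifield u Y ->
        tdiff (g L X Y) u v =
          metric L u (nabla u v X) (Y u) + metric L u (X u) (nabla u v Y),
      forall u X Y, slit u -> smooth_pifield u X -> smooth_pifield u Y ->
        Qtorsion nabla X Y u = 0 &
      forall u X Y Z, slit u ->
        smooth_pifield u X -> smooth_pifield u Y -> smooth_pifield u Z ->
        g L (Ttorsion nabla X Y) Z u = g L (Ttorsion nabla X Z) Y u].

Definition hcurv4 X Y Z W : TM -> R := g L (hcurv nabla X Y Z) W.

Definition Ric0 X : pifield := fun u =>
  xget 0 [set a | forall Y, smooth_pifield u Y ->
                    metric L u a (Y u) = Ric nabla X Y u].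

Definition Sc : TM -> R := trace Ric0.

Definition F X Y : TM -> R := fun u =>
  (n%:R - 2)^-1 * (Ric nabla X Y u - Sc u * g L X Y u / (2 * (n%:R - 1))).

Definition R3_like : Prop :=
  (4 <= n)%N /\
  forall u X Y Z W, slit u ->
    smooth_pifield u X -> smooth_pifield u Y ->
    smooth_pifield u Z -> smooth_pifield u W ->
    hcurv4 X Y Z W u =
      g L X Z u * F Y W u - g L Y Z u * F X W u
      + g L Y W u * F X Z u - g L X W u * F Y Z u.

Definition scalar_curvature : Prop :=
  (3 <= n)%N /\
  exists k : TM -> R, forall u X Y, slit u ->
    smooth_pifield u X -> smooth_pifield u Y ->
    hcurv4 eta X eta Y u = k u * L u ^+ 2 * hbar L X Y u.

Definition p_scalar_curvature : Prop :=
  exists Ro : TM -> R, forall u X Y Z W, slit u ->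
    smooth_pifield u X -> smooth_pifield u Y ->
    smooth_pifield u Z -> smooth_pifield u W ->
    hcurv4 (phi L X) (phi L Y) (phi L Z) (phi L W) u =
      Ro u * (hbar L X Z u * hbar L Y W u - hbar L X W u * hbar L Y Z u).

Definition s_ps_curvature : Prop := scalar_curvature /\ p_scalar_curvature.

End CartanConnection.

(* Main.v *)
Require Import Defs.
From mathcomp Require Import all_boot all_order all_algebra.
From mathcomp Require Import all_classical all_reals all_analysis.
From HB Require Import structures.
From mathcomp Require Import ring lra.

(** Fix a point u of the slit bundle; everything is linear algebra in the
    space of tangent vectors at u, once two facts are known there.

    The first is that the R3 identity, required of all local smooth fields,
    makes F a bilinear form in the values of its arguments at u
    ([R3_form_tensorial]).  Choosing Z orthogonal to Y and pairing with W shows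
    that F(Y, W) depends linearly on the value of W.  For the first argument,
    contract the identity in a coordinate frame e_i: Ric(X, Y) becomes
    t g(X, Y) + (n-1) F(X, Y) - sum_i X^i F(e_i, Y), and comparing with the
    definition of F through Ric and Sc gives, with s = Sc / (2 (n-1)),
    F(X, Y) = sum_i X^i F(e_i, Y) + (s - t) g(X, Y); taking X = e_i yields
    s = t.

    The second is that every vector orthogonal to eta is the value at u of a
    smooth field X with phi(X) = X.  Such a field is L^2 E - g(E, eta) eta, with
    E constant in a chart.  Its smoothness and its orthogonality to eta come
    from homogeneity: by Euler's identity g(E, eta) is half the derivative of
    L^2 along the vertical lift of E ([metric_eta], [metric_eta_chart]), so it
    is smooth, and g(eta, eta) = L^2.

    On the hyperplane orthogonal to eta, of dimension n - 1 >= 3, comparing the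
    R3 form of the curvature with the p-scalar one on orthogonal vectors forces
    F = (Ro / 2) g ([orthogonal_complement_proportional]).  Substituting in
    R(eta, X, eta, Y) and projecting X and Y along eta leaves
    (L^2 Ro / 2 + F(eta, eta)) hbar(X, Y) ([R3_form_scalar]), which is scalar
    curvature. *)

Set Implicit Arguments.
Unset Strict Implicit.
Unset Printing Implicit Defensive.

Import Order.TTheory GRing.Theory Num.Theory.
Import numFieldNormedType.Exports.
(* [coord] is also the coordinate function of finite-dimensional spaces: the
   charts must take precedence. *)
Import Defs.

Local Open Scope classical_set_scope.
Local Open Scope ring_scope.

(** * Bilinear forms satisfying the R3 identity *)

(** [metric L u] is convertible to [bform (g_comp L u)]. *)
Definition bform {R : realFieldType} {n} (B : 'M[R]_n) (x y : 'rV[R]_n) : R :=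
  (x *m B *m y^T) 0 0.

Section BilinearForm.
Context {R : realFieldType} {n : nat} (B : 'M[R]_n).
Implicit Types (x y : 'rV[R]_n).

Lemma bformDl x1 x2 y : bform B (x1 + x2) y = bform B x1 y + bform B x2 y.
Proof. by rewrite /bform !mulmxDl mxE. Qed.

Lemma bformDr x y1 y2 : bform B x (y1 + y2) = bform B x y1 + bform B x y2.
Proof. by rewrite /bform linearD mulmxDr mxE. Qed.

Lemma bformZl a x y : bform B (a *: x) y = a * bform B x y.
Proof. by rewrite /bform -!scalemxAl mxE. Qed.

Lemma bformZr a x y : bform B x (a *: y) = a * bform B x y.
Proof. by rewrite /bform linearZ -scalemxAr mxE. Qed.

Lemma bform_suml (I : finType) (a : I -> R) (v : I -> 'rV[R]_n) y :
  bform B (\sum_i a i *: v i) y = \sum_i a i * bform B (v i) y.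
Proof.
rewrite /bform !mulmx_suml summxE; apply: eq_bigr => i _.
by rewrite -!scalemxAl mxE.
Qed.

Lemma bform_delta x (y : 'rV[R]_n) :
  bform B x y = \sum_i x 0 i * bform B (delta_mx 0 i) y.
Proof. by rewrite {1}[x]row_sum_delta bform_suml. Qed.

Lemma bformE x y : bform B x y = \sum_i \sum_j x 0 i * y 0 j * B i j.
Proof.
rewrite bform_delta; apply: eq_bigr => i _.
rewrite /bform -rowE mxE mulr_sumr; apply: eq_bigr => j _.
by rewrite !mxE mulrA mulrAC.
Qed.

End BilinearForm.

Section Metric.
Context {R : realFieldType} {n : nat} (G : 'M[R]_n).
Hypothesis symG : forall x y, bform G x y = bform G y x.
Hypothesis posG : forall x, x != 0 -> 0 < bform G x x.

(** The vectors orthogonal to [vs] form the kernel of a matrix with [n] rows and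
    only [size vs] columns. *)
Lemma exists_orthogonal (vs : seq 'rV[R]_n) : (size vs < n)%N ->
  exists2 x, x != 0 & {in vs, forall v, bform G x v = 0}.
Proof.
move=> ltn; pose A := G *m (\matrix_(i < size vs) vs`_i)^T.
have : kermx A != 0.
  rewrite kermx_eq0 /row_free neq_ltn (leq_ltn_trans (rank_leq_col A)) //.
case/rowV0Pn => x /sub_kermxP xA x0; exists x => // v /(nthP 0) [i ltis <-].
have /(congr1 (fun m : 'rV_(size vs) => m 0 (Ordinal ltis))) := xA.
rewrite [RHS]mxE /A mulmxA => <-; rewrite /bform !mxE.
by apply: eq_bigr => k _; rewrite !mxE.
Qed.

Lemma metric_unit : G \in unitmx.
Proof.
rewrite -row_free_unit -kermx_eq0; apply/negPn/negP => /rowV0Pn [x /sub_kermxP xG x0].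
by have := posG x0; rewrite /bform xG mul0mx mxE ltxx.
Qed.

Definition dual_frame (i : 'I_n) : 'rV[R]_n := (invmx G *m delta_mx i 0)^T.

(** Expresses coordinates, hence traces, through the metric: the R3 identity
    only determines metric products of the curvature. *)
Lemma bform_dual_frame x i : bform G x (dual_frame i) = x 0 i.
Proof.
by rewrite /bform trmxK -mulmxA mulKVmx ?metric_unit // -colE mxE.
Qed.

(** If x and y are orthogonal and z = x, w = y, the hypothesis reads
    b(x) + b(y) = r for the Rayleigh quotients b(x) = B(x, x) / G(x, x).  In
    dimension at least 3 there are three mutually orthogonal vectors, and the
    three equations give b = r / 2.  Then z = x orthogonal to both y and w turns
    the hypothesis into B(y, w) + b(x) G(y, w) = r G(y, w). *)
Lemma orthogonal_complement_proportional (B : 'M[R]_n) (e : 'rV[R]_n) (r : R) :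
  (4 <= n)%N ->
  (forall x y z w, bform G x e = 0 -> bform G y e = 0 ->
     bform G z e = 0 -> bform G w e = 0 ->
     bform G x z * bform B y w - bform G y z * bform B x w
     + bform G y w * bform B x z - bform G x w * bform B y z =
     r * (bform G x z * bform G y w - bform G x w * bform G y z)) ->
  forall y w, bform G y e = 0 -> bform G w e = 0 ->
    bform B y w = r / 2 * bform G y w.
Proof.
move=> n4 H.
have pairE x y : x != 0 -> bform G x e = 0 -> bform G y e = 0 ->
    bform G x y = 0 -> bform G x x * bform B y y + bform G y y * bform B x x =
                       r * (bform G x x * bform G y y).
  move=> x0 xe ye xy.
  have := H x y x y xe ye xe ye; rewrite [bform G y x]symG xy.
  by rewrite !mul0r !subr0.
have diagE x : bform G x e = 0 -> bform B x x = r / 2 * bform G x x.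
  move=> xe.
  have [|y y0 yP] := @exists_orthogonal [:: e; x]; first exact: ltn_trans n4.
  have [|z z0 zP] := @exists_orthogonal [:: e; x; y]; first exact: n4.
  have [ye yx] : bform G y e = 0 /\ bform G y x = 0.
    by split; apply: yP; rewrite !inE eqxx ?orbT.
  have [ze zx zy] : [/\ bform G z e = 0, bform G z x = 0 & bform G z y = 0].
    by split; apply: zP; rewrite !inE eqxx ?orbT.
  have E1 := pairE _ _ y0 ye xe yx.
  have E2 := pairE _ _ z0 ze xe zx.
  have E3 := pairE _ _ z0 ze ye zy.
  have qy := posG y0; have qz := posG z0.
  have : 2 * (bform G y y * bform G z z) *
           (bform B x x - r / 2 * bform G x x) = 0.
    transitivity (bform G z z * (bform G y y * bform B x x + bform G x x * bform B y y)
      + bform G y y * (bform G z z * bform B x x + bform G x x * bform B z z)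
      - bform G x x * (bform G z z * bform B y y + bform G y y * bform B z z)
      - r * bform G x x * bform G y y * bform G z z); first by field.
    by rewrite E1 E2 E3; ring.
  move/eqP; rewrite mulf_eq0 subr_eq0 => /orP [|/eqP //].
  by rewrite !mulf_eq0 pnatr_eq0 !gt_eqF.
move=> y w ye we.
have [|x x0 xP] := @exists_orthogonal [:: e; y; w]; first exact: n4.
have [xe xy xw] : [/\ bform G x e = 0, bform G x y = 0 & bform G x w = 0].
  by split; apply: xP; rewrite !inE eqxx ?orbT.
have := H x y x w xe ye xe we.
rewrite [bform G y x]symG xy xw diagE // !mul0r !subr0 => E.
apply: (mulfI (lt0r_neq0 (posG x0))).
transitivity (bform G x x * bform B y w + bform G y w * (r / 2 * bform G x x)
  - bform G y w * (r / 2 * bform G x x)); first by ring.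
by rewrite E; field.
Qed.

(** The left-hand side, R(e, x, e, y) for an R3 curvature, vanishes when x or y
    is e; so x and y may be replaced by their projections orthogonal to e, where
    the two mixed terms disappear. *)
Lemma R3_form_scalar (B : 'M[R]_n) (e : 'rV[R]_n) (c : R) :
  bform G e e != 0 ->
  (forall x y, bform G x e = 0 -> bform G y e = 0 ->
     bform B x y = c * bform G x y) ->
  forall x y,
    bform G e e * bform B x y - bform G x e * bform B e y
    + bform G x y * bform B e e - bform G e y * bform B x e =
    (c * bform G e e + bform B e e) *
    (bform G x y - bform G x e * bform G y e / bform G e e).
Proof.
move=> q0 H x y.
pose proj v := v + (- (bform G v e / bform G e e)) *: e.
have proj_orth v : bform G (proj v) e = 0.
  by rewrite bformDl bformZl mulNr divfK // subrr.
have := H (proj x) (proj y) (proj_orth x) (proj_orth y).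
rewrite /proj !(bformDl, bformDr, bformZl, bformZr) [bform G e y]symG.
set q := bform G e e in q0 *; set a := bform G x e; set b := bform G y e.
set m := bform G x y; move=> E.
transitivity (q * (bform B x y + - (b / q) * bform B x e +
    (- (a / q) * bform B e y + - (a / q) * (- (b / q) * bform B e e))) +
    (m - a * b / q) * bform B e e); first by field.
by rewrite E; field.
Qed.

(** [S] stands for the local smooth fields, [ev] for evaluation at the point,
    [c] for the extension of a vector to a field, [K] for the curvature and [P]
    for F.  Here [P] is an arbitrary function of fields; that it depends on
    their values only, bilinearly, comes from comparing the trace of the identity
    for [K] with the formula for [P]. *)
Lemma R3_form_tensorial (S : Type) (ev : S -> 'rV[R]_n) (c : 'rV[R]_n -> S)
    (K : S -> S -> S -> 'rV[R]_n) (P : S -> S -> R) (s : R) :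
  (1 < n)%N -> cancel c ev ->
  (forall X Y Z W, bform G (K X Y Z) (ev W) =
     bform G (ev X) (ev Z) * P Y W - bform G (ev Y) (ev Z) * P X W
     + bform G (ev Y) (ev W) * P X Z - bform G (ev X) (ev W) * P Y Z) ->
  (forall X Y, (n%:R - 2) * P X Y =
     \sum_(i < n) K X (c (delta_mx 0 i)) Y 0 i - s * bform G (ev X) (ev Y)) ->
  exists B : 'M[R]_n, forall X Y, P X Y = bform B (ev X) (ev Y).
Proof.
move=> n1 cK KE PE.
(* Linearity in the second argument: with g(X, Z) = 1 and g(Y, Z) = 0 the
   identity expresses P Y W by metric products with the value of W. *)
have /choice [k kE] Y : exists k, forall W, P Y W = bform G k (ev W).
  have [|z z0 /(_ (ev Y))] := @exists_orthogonal [:: ev Y]; first exact: n1.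
  rewrite mem_head => /(_ isT) zY.
  have q0 := lt0r_neq0 (posG z0).
  exists (K (c ((bform G z z)^-1 *: z)) Y (c z)
    + (- P (c ((bform G z z)^-1 *: z)) (c z)) *: ev Y
    + P Y (c z) *: ((bform G z z)^-1 *: z)) => W.
  rewrite !(bformDl, bformZl) KE !cK bformZl mulVf // [bform G (ev Y) z]symG zY.
  by rewrite bformZl; ring.
pose t := \sum_(i < n) P (c (delta_mx 0 i)) (c (dual_frame i)).
(* Contraction of the second and fourth arguments of the identity. *)
have PX X Y : P X Y = \sum_i ev X 0 i * P (c (delta_mx 0 i)) Y
                      + (s - t) * bform G (ev X) (ev Y).
  have := PE X Y.
  have -> : \sum_i K X (c (delta_mx 0 i)) Y 0 i =
      t * bform G (ev X) (ev Y) - P X Y + n%:R * P X Y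
      - \sum_i ev X 0 i * P (c (delta_mx 0 i)) Y.
    have -> : n%:R * P X Y = \sum_(i < n) P X Y.
      by rewrite sumr_const card_ord mulr_natl.
    have -> : P X Y = \sum_i k X 0 i * bform G (delta_mx 0 i) (ev Y).
      by rewrite kE -bform_delta.
    rewrite mulr_suml -!sumrB -big_split -sumrB; apply: eq_bigr => i _ /=.
    rewrite -[K _ _ _ 0 i]bform_dual_frame -[dual_frame i]cK KE !cK.
    rewrite !bform_dual_frame [P X (c (dual_frame i))]kE cK bform_dual_frame.
    by rewrite -bform_delta -kE mxE !eqxx /=; ring.
  set p := P X Y; set sigma := \sum_i _; set m := bform G _ _ => E.
  transitivity (p + (n%:R - 2) * p - (n%:R - 2) * p); first by rewrite addrK.
  by rewrite {2}E; ring.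
(* On a frame field the sum in [PX] is the left-hand side itself. *)
have st : s - t = 0.
  pose i0 : 'I_n := Ordinal (ltn_trans (ltn0Sn 0) n1).
  have := PX (c (delta_mx 0 i0)) (c (delta_mx 0 i0)).
  rewrite !cK (bigD1 i0) //= mxE !eqxx mul1r big1 ?addr0; last first.
    by move=> i /negbTE i0i; rewrite mxE i0i andbF mul0r.
  move/eqP; rewrite -subr_eq0 opprD addrA subrr sub0r oppr_eq0 mulf_eq0.
  have d0 : delta_mx 0 i0 != 0 :> 'rV[R]_n.
    apply/eqP => /(congr1 (fun v : 'rV_n => v 0 i0))/eqP.
    by rewrite !mxE !eqxx oner_eq0.
  by rewrite (gt_eqF (posG d0)) orbF => /eqP.
exists ((\matrix_(i < n) k (c (delta_mx 0 i))) *m G) => X Y.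
rewrite PX st mul0r addr0 [RHS]bform_delta; apply: eq_bigr => i _.
by rewrite kE /bform mulmxA -rowE rowK.
Qed.

End Metric.

(** * Calculus of smooth maps *)

Section Differential.
Context {R : realType}.

Lemma near_neq0 (V : normedModType R) (x : V) : x != 0 -> \forall y \near x, y != 0.
Proof.
move=> x0; apply/nbhs_ballP; exists `|x|; first by rewrite /= normr_gt0.
move=> y; rewrite -ball_normE /ball_ /=; apply: contraTneq => ->.
by rewrite subr0 ltxx.
Qed.

Lemma is_diff_near0 (V W : normedModType R) (e : V -> W) (x : V) :
  (\forall y \near x, e y = 0) -> is_diff x e \0.
Proof.
move=> e0.
have null_cont : continuous (\0 : V -> W) by move=> y; exact: cvg_cst.
have expand : e \o shift x = cst (e x) + (\0 : V -> W) +o_ 0 id.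
  apply/eqaddoP => _/posnumP[eps]; have := e0; rewrite (near_shift 0) => e0'.
  rewrite near_simpl; near=> y => /=.
  have -> : (e \o shift x - (cst (e x) + (\0 : V -> W))) y = 0.
    rewrite !fctE /= (nbhs_singleton e0) addr0 subr0.
    by near: y; move: e0'; apply: filterS => y /=; rewrite subr0.
  by rewrite normr0 mulr_ge0.
have de : 'd e x = (\0 : V -> W) :> (V -> W).
  by apply: diff_unique => //; exact: null_cont.
by apply: DiffDef => //; apply/diff_locallyP; rewrite de; split.
Unshelve. all: by end_near. Qed.

Lemma is_diffE (V W : normedModType R) (f df : V -> W) (x : V) :
  is_diff x f df -> forall v, 'd f x v = df v.
Proof. by move=> fdf v; have -> := @diff_val _ _ _ _ _ _ _ fdf. Qed.

(** Differentials are local: [h - f] vanishes near [x], so its differential is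
    zero. *)
Lemma near_is_diff (V W : normedModType R) (f h df : V -> W) (x : V) :
  (\forall y \near x, f y = h y) -> is_diff x f df -> is_diff x h df.
Proof.
move=> fh fdf.
have d0 : is_diff x (h - f) \0.
  by apply: is_diff_near0; apply: filterS fh => y fhy; rewrite !fctE fhy subrr.
have := is_diffD fdf d0.
rewrite addrC subrK; have -> // : df + (\0 : V -> W) = df.
by rewrite funeqE => y; rewrite !fctE /= addr0.
Qed.

Lemma is_diff_near_id (V : normedModType R) (f : V -> V) (x : V) :
  (\forall y \near x, f y = y) -> is_diff x f id.
Proof.
by move=> fE; apply: (near_is_diff (f := id)); apply: filterS fE => y ->.
Qed.

Lemma is_diff_scale (V W : normedModType R) (f df : V -> R) (h dh : V -> W) x :
  is_diff x f df -> is_diff x h dh ->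
  is_diff x (fun z => f z *: h z) (fun v => f x *: dh v + df v *: h x).
Proof.
move=> fdf hdh.
have bl : bilinear_for (GRing.Scale.Law.clone _ _ *:%R _)
    (GRing.Scale.Law.clone _ _ *:%R _) (fun (a : R) (w : W) => a *: w).
  split=> [w|a] b y z /=.
    by rewrite scalerDl scalerA.
  by rewrite scalerDr !scalerA mulrC.
pose blM := bilinear_isBilinear.Build R R W W _ _ (fun (a : R) (w : W) => a *: w) bl.
pose sc : {bilinear R -> W -> W} := HB.pack (fun (a : R) (w : W) => a *: w) blM.
have scc : continuous (fun p : R * W => sc p.1 p.2) by exact: scale_continuous.
have dsc : is_diff (f x, h x) (fun p : R * W => p.1 *: p.2)
    (fun q => f x *: q.2 + q.1 *: h x).
  apply: DiffDef; first exact: (differentiable_bilin _ scc).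
  exact: (diff_bilin _ scc).
have dp := is_diff_pair fdf hdh.
exact: (is_diff_comp dp dsc).
Qed.

End Differential.

Section CkCalculus.
Context {R : realType} {V : normedModType R}.
Variables (O : set V) (oO : open O).
Implicit Types (W : normedModType R).

Let near_O x : O x -> \forall y \near x, O y.
Proof. by move=> Ox; apply: open_nbhs_nbhs; split. Qed.

Lemma eq_Ck W k (f h : V -> W) :
  (forall x, O x -> f x = h x) -> Ck k O f -> Ck k O h.
Proof.
elim: k f h => [|k IH] f h fh /=.
  move=> fc x Ox; suff : h @ x --> f x by rewrite fh.
  apply: cvg_trans (fc x Ox); apply: near_eq_cvg.
  by near=> y; rewrite fh //; near: y; exact: near_O.
have dfh x : O x -> differentiable f x -> is_diff x h ('d f x).
  move=> Ox /differentiableP; apply: near_is_diff.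
  by near=> y; rewrite fh //; near: y; exact: near_O.
move=> [fd fk]; split=> [x Ox|v]; first by case: (dfh x Ox (fd x Ox)).
apply: IH (fk v) => x Ox.
exact: esym (is_diffE (dfh x Ox (fd x Ox)) v).
Unshelve. all: by end_near. Qed.

Lemma Ck_continuous W k (f : V -> W) :
  Ck k O f -> forall x, O x -> {for x, continuous f}.
Proof.
by case: k => [//|k] [fd _] x /fd; exact: differentiable_continuous.
Qed.

Lemma CkW W k (f : V -> W) : Ck k.+1 O f -> Ck k O f.
Proof.
elim: k f => [|k IH] f; first exact: Ck_continuous.
by move=> [fd fk]; split=> // v; apply: IH.
Qed.

Lemma CkD W k (f h : V -> W) : Ck k O f -> Ck k O h ->
  Ck k O (fun x => f x + h x).
Proof.
elim: k f h => [|k IH] f h /=.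
  by move=> fc hc x Ox; apply: cvgD; [exact: fc|exact: hc].
move=> [fd fk] [hd hk]; split=> [x Ox|v].
  by apply: differentiableD; [exact: fd|exact: hd].
apply: eq_Ck (IH _ _ (fk v) (hk v)) => x Ox.
exact: esym (congr1 (fun l => l v) (diffD (fd _ Ox) (hd _ Ox))).
Qed.

Lemma CkZ W k (f : V -> R) (h : V -> W) : Ck k O f -> Ck k O h ->
  Ck k O (fun x => f x *: h x).
Proof.
elim: k f h => [|k IH] f h.
  by move=> fc hc x Ox; apply: cvgZ; [exact: fc|exact: hc].
move=> fk1 hk1; have [fd fk] := fk1; have [hd hk] := hk1.
have dfh x : O x -> is_diff x (fun z => f z *: h z)
    (fun v => f x *: 'd h x v + 'd f x v *: h x).
  by move=> Ox; apply: is_diff_scale; apply: differentiableP; [exact: fd|exact: hd].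
split=> [x Ox|v]; first by case: (dfh x Ox).
have := CkD (IH _ _ (CkW fk1) (hk v)) (IH _ _ (fk v) (CkW hk1)).
apply: eq_Ck => x Ox.
exact: esym (is_diffE (dfh x Ox) v).
Qed.

Lemma Ck_cst W k (a : W) : Ck k O (cst a).
Proof.
elim: k a => [|k IH] a /=; first by move=> x _; exact: cst_continuous.
split=> [x _|v]; first exact: differentiable_cst.
by apply: eq_Ck (IH 0) => x _; rewrite diff_cst.
Qed.

Lemma Ck_linear W k (l : {linear V -> W}) : continuous l -> Ck k O l.
Proof.
case: k => [|k] lc /=; first by move=> x _; exact: lc.
split=> [x _|v]; first exact: linear_differentiable.
by apply: eq_Ck (Ck_cst k (l v)) => x _; rewrite diff_lin.
Qed.

End CkCalculus.

Section SmoothNear.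
Context {R : realType} {V : normedModType R} (x : V).
Implicit Types (W : normedModType R).

Lemma Ck_subset W k (A B : set V) (f : V -> W) : A `<=` B -> Ck k B f -> Ck k A f.
Proof.
move=> AB; elim: k f => [|k IH] f; first by move=> fc y /AB; exact: fc.
by move=> [fd fk]; split=> [y /AB|v]; [exact: fd|exact: IH (fk v)].
Qed.

Lemma near_smooth W (f h : V -> W) :
  (\forall y \near x, f y = h y) -> smooth_near x f -> smooth_near x h.
Proof.
move=> nfh [B Bx fB].
have [A Ax fh] : exists2 A, open_nbhs x A & A `<=` [set y | f y = h y].
  by have := nfh; rewrite /prop_near1 nbhsE.
exists (A `&` B); first exact: open_nbhsI.
move=> k; have [oAB _] := open_nbhsI Ax Bx.
by apply: (eq_Ck oAB _ (Ck_subset _ (fB k))) => [y [/fh]|y []].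
Qed.

Lemma smooth_nearD W (f h : V -> W) :
  smooth_near x f -> smooth_near x h -> smooth_near x (fun y => f y + h y).
Proof.
move=> [A Ax fA] [B Bx hB]; exists (A `&` B); first exact: open_nbhsI.
have [oAB _] := open_nbhsI Ax Bx.
by move=> k; apply: (CkD oAB); [apply: Ck_subset (fA k)|apply: Ck_subset (hB k)] => y [].
Qed.

Lemma smooth_nearZ W (f : V -> R) (h : V -> W) :
  smooth_near x f -> smooth_near x h -> smooth_near x (fun y => f y *: h y).
Proof.
move=> [A Ax fA] [B Bx hB]; exists (A `&` B); first exact: open_nbhsI.
have [oAB _] := open_nbhsI Ax Bx.
by move=> k; apply: (CkZ oAB); [apply: Ck_subset (fA k)|apply: Ck_subset (hB k)] => y [].
Qed.

Lemma smooth_near_cst W (a : W) : smooth_near x (cst a).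
Proof. by exists setT => [|k]; [exact: open_nbhsT|apply: Ck_cst; exact: openT]. Qed.

Lemma smooth_near_linear W (l : {linear V -> W}) : continuous l -> smooth_near x l.
Proof.
move=> lc; exists setT => [|k]; [exact: open_nbhsT|].
by apply: Ck_linear => //; exact: openT.
Qed.

Lemma smooth_near_derive W (f : V -> W) v :
  smooth_near x f -> smooth_near x (fun y => 'D_v f y).
Proof.
case=> A [oA Ax] fA; exists A => // k; have [fd fk] := fA k.+1.
by apply: (eq_Ck oA _ (fk v)) => y /fd /deriveE ->.
Qed.

Lemma smooth_near_differentiable W (f : V -> W) :
  smooth_near x f -> \forall y \near x, differentiable f y.
Proof.
by case=> A Ax /(_ 1) [fd _]; exact: filterS fd (open_nbhs_nbhs Ax).
Qed.

End SmoothNear.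

(** * Charts of the tangent bundle *)

Section Charts.
Context {R : realType} {n : nat} {M : smoothManifold R n}.
Implicit Types (c d : chart M) (q : M) (u : tangent M).

Lemma coordIK c x : (coord c @` dom c) x -> coord c (coordI c x) = x.
Proof. by case=> p pc <-; rewrite coordK. Qed.

Lemma dom_coordI c x : (coord c @` dom c) x -> dom c (coordI c x).
Proof. by case=> p pc <-; rewrite coordK. Qed.

Lemma near_image c q : dom c q -> \forall x \near coord c q, (coord c @` dom c) x.
Proof.
by move=> qc; apply: open_nbhs_nbhs; split; [exact: image_open|exists q].
Qed.

Lemma transition_differentiable c d q : dom c q -> dom d q ->
  differentiable (coord d \o coordI c) (coord c q).
Proof.
by move=> qc qd; have [+ _] := @transition_smooth _ _ M c d 1; apply; exists q.
Qed.

Lemma transitionK c d q : dom c q -> dom d q ->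
  \forall x \near coord c q, coord c (coordI d (coord d (coordI c x))) = x.
Proof.
move=> qc qd.
have qd' : \forall x \near coord c q, dom d (coordI c x).
  have := @coordI_continuous _ _ _ _ _ qc; apply.
  by rewrite coordK //; apply: open_nbhs_nbhs; split=> //; exact: dom_open.
near=> x; rewrite coordK; last by near: x.
by apply: coordIK; near: x; exact: near_image.
Unshelve. all: by end_near. Qed.

(** Chain rule for the two transition maps, which are inverse to each other only
    near the point. *)
Lemma diff_transitionK c d q v : dom c q -> dom d q ->
  'd (coord c \o coordI d) (coord d q)
    ('d (coord d \o coordI c) (coord c q) v) = v.
Proof.
move=> qc qd.
have E : coord d q = (coord d \o coordI c) (coord c q) by rewrite /ssrfun.comp coordK.
have fd := transition_differentiable qc qd.
have := transition_differentiable qd qc; rewrite E => hd.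
have idd : is_diff (coord c q) ((coord c \o coordI d) \o (coord d \o coordI c)) id.
  by apply: is_diff_near_id; exact: transitionK.
have comp_diff := congr1 (fun k => k v) (diff_comp fd hd).
exact: etrans (esym comp_diff) (is_diffE idd v).
Qed.

Lemma comp_backK c q : dom c q -> cancel (comp_back c q) (comp c q).
Proof. by move=> qc v; apply: diff_transitionK => //; exact: dom_chart_at. Qed.

Lemma comp_chart_at q v : comp (chart_at q) q v = v.
Proof.
have idd : is_diff (coord (chart_at q) q)
    (coord (chart_at q) \o coordI (chart_at q)) id.
  apply: is_diff_near_id.
  by apply: filterS (near_image (dom_chart_at q)) => x; exact: coordIK.
exact: is_diffE idd v.
Qed.

Lemma comp_back_chart_at q v : comp_back (chart_at q) q v = v.
Proof. exact: comp_chart_at. Qed.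

Lemma comp_backD c q v w : comp_back c q (v + w) = comp_back c q v + comp_back c q w.
Proof. exact: linearD. Qed.

Lemma comp_backZ c q a v : comp_back c q (a *: v) = a *: comp_back c q v.
Proof. exact: linearZ. Qed.

Lemma comp_back_eq0 c q v : dom c q -> (comp_back c q v == 0) = (v == 0).
Proof.
move=> qc; have z : comp_back c q 0 = 0 by exact: linear0.
by rewrite -[in LHS]z (can_eq (comp_backK qc)).
Qed.

Lemma tcoord_chart_at u :
  tcoord (tchart_at u) u = (coord (chart_at (base u)) (base u), vec u).
Proof. by rewrite /tcoord comp_chart_at. Qed.

Lemma tcoordI_chart_at u y :
  tcoordI (tchart_at u) (coord (chart_at (base u)) (base u), y) = Tangent (base u) y.
Proof.
by rewrite /tcoordI /= coordK ?comp_back_chart_at //; exact: dom_chart_at.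
Qed.

Lemma tcoordK u : tcoordI (tchart_at u) (tcoord (tchart_at u) u) = u.
Proof. by rewrite tcoord_chart_at tcoordI_chart_at; case: u. Qed.

Definition slit_image c : set ('rV[R]_n * 'rV[R]_n) :=
  [set z | (coord c @` dom c) z.1 /\ z.2 != 0].

Lemma slit_tcoordI c z : slit_image c z -> slit (tcoordI c z).
Proof. by case=> zc z2; rewrite /slit /= comp_back_eq0 //; exact: dom_coordI. Qed.

Lemma near_slit_image u : slit u ->
  \forall z \near tcoord (tchart_at u) u, slit_image (tchart_at u) z.
Proof.
move=> su; rewrite tcoord_chart_at.
have N := near_neq0 su.
have := near_image (dom_chart_at (base u)).
move=> I.
by exists (coord (chart_at (base u)) @` dom (chart_at (base u)), [set y | y != 0]).
Qed.

End Charts.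

(** * Euler's identities for the squared Finsler function *)

Section FinslerCalculus.
Context {R : realType} {n : nat} {M : smoothManifold R n} (L : tangent M -> R).
Hypothesis finslerL : finsler L.
Implicit Types (c d : chart M) (q : M) (u : tangent M).

Definition energy c (z : 'rV[R]_n * 'rV[R]_n) : R := L (tcoordI c z) ^+ 2.

Lemma energy_homogeneous c z t : slit_image c z -> 0 < t ->
  energy c (z.1, t *: z.2) = t ^+ 2 * energy c z.
Proof.
move=> zc t0; have [hom _ _ _] := finslerL.
rewrite /energy -exprMn -(hom (tcoordI c z)) //; last exact: slit_tcoordI.
by rewrite /tcoordI /= comp_backZ.
Qed.

Lemma smooth_energy u : slit u ->
  smooth_near (tcoord (tchart_at u) u) (energy (tchart_at u)).
Proof.
move=> su; have [_ sm _ _] := finslerL; case: (sm _ su) => U zU sU.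
exists U => // k; have [oU _] := zU.
by apply: (eq_Ck oU _ (CkZ oU (sU k) (sU k))).
Qed.

(** Homogeneity of degree 2: along the ray the difference quotient is
    ((1 + h)^2 - 1) / h = 2 + h times the value. *)
Lemma derive_energy_radial c z : slit_image c z ->
  'D_(0, z.2) (energy c) z = 2 * energy c z.
Proof.
move=> zc; apply: cvg_lim => //.
have E : \forall h \near (0 : R)^',
    (2 + h) * energy c z = h^-1 *: (energy c (h *: (0, z.2) + z) - energy c z).
  near=> h.
  have -> : h *: (0, z.2) + z = (z.1, (1 + h) *: z.2).
    case: (z) => a b /=; rewrite scalerDl scale1r addrC.
    by congr (_, _); rewrite /= ?scaler0 ?addr0.
  rewrite energy_homogeneous //; last first.
    have : `|h| < 1 by near: h; exact: dnbhs0_lt.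
    by rewrite ltr_norml => /andP[]; lra.
  have h0 : h != 0 by near: h; exact: nbhs_dnbhs_neq.
  by rewrite /GRing.scale /=; field.
apply: cvg_trans (near_eq_cvg E) _.
have cont : (fun h : R => (2 + h) * energy c z) @ 0 --> (2 + 0) * energy c z.
  by apply: cvgMl; apply: cvgD; [exact: cvg_cst|exact: cvg_id].
rewrite addr0 in cont.
exact: cvg_trans (cvg_app _ (@nbhs_dnbhs _ 0)) cont.
Unshelve. all: by end_near. Qed.

Section AtSlitPoint.
Variables (u : tangent M) (su : slit u).
Let c := tchart_at u.
Let z0 := tcoord c u.

Definition fibre_derivative j z := 'D_(0, delta_mx 0 j) (energy c) z.

Lemma differentiable_energy : \forall z \near z0, differentiable (energy c) z.
Proof.
exact: smooth_near_differentiable (smooth_energy su).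
Qed.

Lemma differentiable_fibre_derivative j : differentiable (fibre_derivative j) z0.
Proof.
case: (smooth_energy su) => U zU sU; have [diffU diff2U] := sU 2.
have [d2 _] := diff2U (0, delta_mx 0 j).
have := differentiableP (d2 z0 (proj2 zU)).
have E : \forall z \near z0,
    'd (energy c) z (0, delta_mx 0 j) = fibre_derivative j z.
  by apply: filterS differentiable_energy => z /deriveE <-.
by move=> /(near_is_diff E) [].
Qed.

Lemma diff_fibre_sum (f : 'rV[R]_n * 'rV[R]_n -> R) z (y : 'rV[R]_n) :
  'd f z (0, y) = \sum_j y 0 j * 'd f z (0, delta_mx 0 j).
Proof.
have -> : (0, y) = \sum_j y 0 j *: (0, delta_mx 0 j) :> 'rV[R]_n * 'rV[R]_n.
  rewrite {1}[y]row_sum_delta; elim/big_rec2: _ => //= i a b _ <-.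
  by congr (_, _); rewrite /= ?scaler0 ?addr0.
by rewrite linear_sum; apply: eq_bigr => j _; rewrite linearZ.
Qed.

(** In this form the first derivatives are taken along the second argument, as
    in Euler's identity for L^2, which [metric_eta] differentiates. *)
Lemma metric_fibre_derivative x y : metric L u x y =
  2^-1 * \sum_j y 0 j * 'd (fibre_derivative j) z0 (0, x).
Proof.
rewrite -[LHS]/(bform (g_comp L u) x y) bformE exchange_big mulr_sumr.
apply: eq_bigr => j _; rewrite diff_fibre_sum !mulr_sumr; apply: eq_bigr => i _.
rewrite mxE -(deriveE _ (differentiable_fibre_derivative j)).
by rewrite -/(energy c) -/z0 /fibre_derivative; ring.
Qed.

(** Differentiate the Euler identity sum_j y^j d_j(L^2) = 2 L^2 in the vertical
    direction x: this gives D_x(L^2) + sum_j y^j D_x d_j(L^2) = 2 D_x(L^2), where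
    the sum is twice the metric product of x and eta. *)
Lemma metric_eta x : metric L u x (vec u) = 2^-1 * 'D_(0, x) (energy c) z0.
Proof.
have denergy := nbhs_singleton differentiable_energy.
rewrite metric_fibre_derivative; congr (_ * _).
have euler : \forall z \near (z0 : 'rV[R]_n * 'rV[R]_n),
    \sum_j (z.2 : 'rV[R]_n) 0 j * fibre_derivative j z = 2 * energy c z.
  apply: filterS2 (near_slit_image su) differentiable_energy => z zc dz.
  rewrite -derive_energy_radial // deriveE // diff_fibre_sum.
  by apply: eq_bigr => j _; rewrite /fibre_derivative deriveE.
have coord_derive j : is_derive z0 (0, x)
    (fun z : 'rV[R]_n * 'rV[R]_n => z.2 0 j) (x 0 j).
  have quotient : (fun h : R => h^-1 *: ((h *: (0, x) + z0).2 0 j - z0.2 0 j)) @ 0^'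
      --> x 0 j.
    apply: cvg_trans (near_eq_cvg _) (cvg_cst (x 0 j)); near=> h.
    have h0 : h != 0 by near: h; exact: nbhs_dnbhs_neq.
    by rewrite !mxE addrK /GRing.scale /= mulKf.
  by apply: DeriveDef; [apply/cvg_ex; exists (x 0 j)|exact: cvg_lim].
have summand_derive j : is_derive z0 (0, x)
    (fun z => z.2 0 j * fibre_derivative j z)
    (vec u 0 j * 'd (fibre_derivative j) z0 (0, x)
     + x 0 j * 'd (energy c) z0 (0, delta_mx 0 j)).
  have fd := differentiable_fibre_derivative j.
  have := is_deriveM (coord_derive j) (derivableP (diff_derivable (v := (0, x)) fd)).
  move/is_derive_eq; apply; rewrite (deriveE _ fd) /fibre_derivative (deriveE _ denergy).
  by rewrite /z0 tcoord_chart_at /= /GRing.scale /= [x 0 j * _]mulrC.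
have sum_derive := is_derive_sum summand_derive.
have twice_derive : is_derive z0 (0, x) (fun z => 2 * energy c z)
    (2 * 'D_(0, x) (energy c) z0).
  exact: is_deriveZ (derivableP (diff_derivable (v := (0, x)) denergy)).
have twice_sum : is_derive z0 (0, x) (fun z => 2 * energy c z)
    (\sum_j (vec u 0 j * 'd (fibre_derivative j) z0 (0, x)
     + x 0 j * 'd (energy c) z0 (0, delta_mx 0 j))).
  apply: near_eq_is_derive sum_derive.
  by apply: filterS euler => z <-; rewrite fct_sumE.
have sumE : \sum_j x 0 j * 'd (energy c) z0 (0, delta_mx 0 j) = 'D_(0, x) (energy c) z0.
  exact: etrans (esym (diff_fibre_sum _ _ _)) (esym (deriveE _ denergy)).
have := @derive_val _ _ _ _ _ _ _ twice_sum.
rewrite (@derive_val _ _ _ _ _ _ _ twice_derive) big_split /=.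
rewrite sumE => E.
by apply: (addIr ('D_(0, x) (energy c) z0)); rewrite -E mulr_natl mulr2n.
Unshelve. all: by end_near. Qed.

End AtSlitPoint.

End FinslerCalculus.

(** * Smooth fields fixed by the projector phi *)

Section SmoothFields.
Context {R : realType} {n : nat} {M : smoothManifold R n}.
Implicit Types (c : chart M) (u : tangent M).

Definition chart_field c (e : 'rV[R]_n) : @pifield R n M :=
  fun u => comp_back c (base u) e.

Lemma chart_field_at u e : chart_field (tchart_at u) e u = e.
Proof. exact: comp_back_chart_at. Qed.

Lemma smooth_pifield_eq u (Z : @pifield R n M) (f : 'rV[R]_n * 'rV[R]_n -> 'rV[R]_n) :
  slit u -> smooth_near (tcoord (tchart_at u) u) f ->
  (forall z, slit_image (tchart_at u) z ->
     comp (tchart_at u) (coordI (tchart_at u) z.1) (Z (tcoordI (tchart_at u) z)) = f z) ->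
  smooth_pifield u Z.
Proof.
move=> su fsm Zf; apply: near_smooth fsm.
by apply: filterS (near_slit_image su) => z /Zf /= ->.
Qed.

(** These fields extend any vector at [u]; on basis vectors they are the
    [frame u i]. *)
Lemma smooth_chart_field u e : slit u -> smooth_pifield u (chart_field (tchart_at u) e).
Proof.
move=> su; apply: (smooth_pifield_eq su (smooth_near_cst _ e)) => z [zc _].
by rewrite /chart_field /= comp_backK //; exact: dom_coordI.
Qed.

Lemma smooth_snd (z : 'rV[R]_n * 'rV[R]_n) :
  smooth_near z (fun z' : 'rV[R]_n * 'rV[R]_n => z'.2).
Proof. by apply: smooth_near_linear => y; exact: cvg_snd. Qed.

Lemma smooth_eta u : slit u -> smooth_pifield u (@eta R n M).
Proof.
move=> su; apply: (smooth_pifield_eq su (smooth_snd _)) => z [zc _].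
by rewrite /eta /= comp_backK //; exact: dom_coordI.
Qed.

End SmoothFields.

Section FinslerMetric.
Context {R : realType} {n : nat} {M : smoothManifold R n} (L : tangent M -> R).
Hypothesis finslerL : finsler L.
Implicit Types (c d : chart M) (q : M) (u : tangent M).

Lemma metric_eta_eta u : slit u -> metric L u (vec u) (vec u) = L u ^+ 2.
Proof.
move=> su; rewrite (metric_eta finslerL su).
have z0c := nbhs_singleton (near_slit_image su).
have := derive_energy_radial finslerL z0c.
have -> : (tcoord (tchart_at u) u).2 = vec u by rewrite tcoord_chart_at.
move=> ->.
by rewrite /energy tcoordK mulKf // pnatr_eq0.
Qed.

Lemma L_neq0 u : slit u -> L u != 0.
Proof.
move=> su; have [_ _ _ pos] := finslerL.
by have := pos u _ su su; rewrite metric_eta_eta // => /lt0r_neq0; rewrite expf_eq0.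
Qed.

(** The metric at a point is computed in the preferred chart of that point, which
    jumps from point to point.  Along a fibre the two charts differ by a linear
    map, so the difference quotients of L^2 agree, and the product with eta is
    read off in the single chart [c], smoothly in [z]. *)
Lemma metric_eta_chart c z e : slit_image c z ->
  metric L (tcoordI c z) (chart_field c e (tcoordI c z)) (vec (tcoordI c z)) =
  2^-1 * 'D_(0, e) (energy L c) z.
Proof.
move=> zc; rewrite (metric_eta finslerL (slit_tcoordI zc)); congr (_ * _).
have E k : tcoordI (tchart_at (tcoordI c z))
    (k *: (0, chart_field c e (tcoordI c z))
     + tcoord (tchart_at (tcoordI c z)) (tcoordI c z)) = tcoordI c (k *: (0, e) + z).
  rewrite tcoord_chart_at.
  have -> : k *: (0, chart_field c e (tcoordI c z)) +
      (coord (chart_at (base (tcoordI c z))) (base (tcoordI c z)), vec (tcoordI c z)) =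
      (coord (chart_at (base (tcoordI c z))) (base (tcoordI c z)),
       k *: chart_field c e (tcoordI c z) + vec (tcoordI c z)).
    by congr (_, _); rewrite /= scaler0 add0r.
  rewrite tcoordI_chart_at /tcoordI /chart_field /= scaler0 add0r.
  by rewrite comp_backD comp_backZ.
have := E 0; rewrite !scale0r !add0r => E0.
have quotientE h : h^-1 *: (energy L (tchart_at (tcoordI c z))
      (h *: (0, chart_field c e (tcoordI c z))
       + tcoord (tchart_at (tcoordI c z)) (tcoordI c z))
    - energy L (tchart_at (tcoordI c z)) (tcoord (tchart_at (tcoordI c z)) (tcoordI c z)))
    = h^-1 *: (energy L c (h *: (0, e) + z) - energy L c z).
  by rewrite /energy E E0.
by rewrite /derive; under eq_fun do rewrite /= quotientE.
Qed.

(** L^2 times phi of the chart field; the factor clears the denominators in the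
    definition of phi. *)
Definition angular_field c (e : 'rV[R]_n) : @pifield R n M := fun u =>
  L u ^+ 2 *: chart_field c e u
  - metric L u (chart_field c e u) (vec u) *: vec u.

Lemma smooth_angular_field u e :
  slit u -> smooth_pifield u (angular_field (tchart_at u) e).
Proof.
move=> su; set c := tchart_at u.
have esm := smooth_energy finslerL su.
have := smooth_nearD (smooth_nearZ esm (smooth_near_cst _ e))
  (smooth_nearZ (smooth_nearZ (smooth_near_cst _ (- 2^-1 : R))
     (smooth_near_derive (0, e) esm)) (smooth_snd _)).
move/(smooth_pifield_eq su); apply => z zc.
have qc := dom_coordI (proj1 zc).
rewrite /angular_field (metric_eta_chart _ zc).
have compB v w :
    comp c (coordI c z.1) (v - w) = comp c (coordI c z.1) v - comp c (coordI c z.1) w.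
  exact: linearB.
have compZ a v : comp c (coordI c z.1) (a *: v) = a *: comp c (coordI c z.1) v.
  exact: linearZ.
rewrite -/c compB !compZ /chart_field /= !comp_backK //.
by rewrite /energy /GRing.scale /= mulNr -scaleNr.
Qed.

Lemma angular_field_orthogonal c e u : slit u ->
  metric L u (angular_field c e u) (vec u) = 0.
Proof.
move=> su; rewrite -[LHS]/(bform _ _ _) /angular_field -scaleNr bformDl !bformZl.
by rewrite [X in _ + _ * X]metric_eta_eta // /bform -/(metric _ _ _ _); ring.
Qed.

(** Holds at zero vectors too, where eta vanishes, so that it is an equality of
    fields and can be rewritten inside the curvature. *)
Lemma phi_angular_field c e : phi L (angular_field c e) = angular_field c e.
Proof.
apply/funext => u; rewrite /phi /ell /g /eta.
have [->|su] := eqVneq (vec u) 0; first by rewrite scaler0 subr0.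
by rewrite angular_field_orthogonal // !mulr0 scale0r subr0.
Qed.

Lemma angular_field_at u e : metric L u e (vec u) = 0 ->
  angular_field (tchart_at u) e u = L u ^+ 2 *: e.
Proof. by move=> ue; rewrite /angular_field chart_field_at ue scale0r subr0. Qed.

End FinslerMetric.

(** * R3-like manifolds of p-scalar curvature *)

Theorem theorem3p53 (R : realType) (n : nat) (M : smoothManifold R n)
    (L : tangent M -> R)
    (nabla : tangent M -> @tvector R n -> @pifield R n M -> 'rV[R]_n) :
  finsler L -> cartan_connection L nabla ->
  R3_like L nabla -> p_scalar_curvature L nabla -> s_ps_curvature L nabla.
Proof.
move=> finslerL _ [n4 R3] psc; split; last exact: psc.
split; first exact: ltnW.
have [Ro RoE] := psc; have [_ _ sym pos] := finslerL.
suff /choice [k kE] u : exists k, slit u -> forall X Y, smooth_pifield u X ->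
    smooth_pifield u Y ->
    hcurv4 L nabla (@eta R n M) X (@eta R n M) Y u = k * L u ^+ 2 * hbar L X Y u.
  by exists k => u X Y su; exact: kE.
have [su|/negP su] := boolP (vec u != 0); last by exists 0.
pose G := g_comp L u.
have symG x y : bform G x y = bform G y x by exact: sym.
have posG x : x != 0 -> 0 < bform G x x by exact: pos.
pose S := {X : @pifield R n M | smooth_pifield u X}.
pose lift v : S := exist _ _ (smooth_chart_field v su).
have [B BE] : exists B : 'M[R]_n, forall X Y : S,
    F L nabla (sval X) (sval Y) u = bform B (sval X u) (sval Y u).
  apply: (R3_form_tensorial (G := G) (c := lift) symG posG
    (K := fun X Y Z => hcurv nabla (sval X) (sval Y) (sval Z) u)
    (s := Sc L nabla u / (2 * (n%:R - 1)))).
  - exact: leq_trans n4.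
  - by move=> v; exact: chart_field_at.
  - by move=> X Y Z W; apply: (R3 u) => //; apply: proj2_sig.
  - move=> X Y; rewrite /F mulVKf; last first.
      by rewrite subr_eq0 eqr_nat; apply: contraTneq n4 => ->.
    by rewrite mulrAC.
have {}R3 X Y Z W : smooth_pifield u X -> smooth_pifield u Y ->
    smooth_pifield u Z -> smooth_pifield u W ->
    hcurv4 L nabla X Y Z W u =
      bform G (X u) (Z u) * bform B (Y u) (W u) - bform G (Y u) (Z u) * bform B (X u) (W u)
    + bform G (Y u) (W u) * bform B (X u) (Z u) - bform G (X u) (W u) * bform B (Y u) (Z u).
  move=> Xs Ys Zs Ws; rewrite R3 //.
  rewrite (BE (exist _ _ Ys) (exist _ _ Ws)) (BE (exist _ _ Xs) (exist _ _ Ws)).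
  by rewrite (BE (exist _ _ Xs) (exist _ _ Zs)) (BE (exist _ _ Ys) (exist _ _ Zs)).
have L0 := L_neq0 finslerL su.
have Bperp : forall y w, bform G y (vec u) = 0 -> bform G w (vec u) = 0 ->
    bform B y w = Ro u / 2 * bform G y w.
  apply: orthogonal_complement_proportional symG posG _ _ _ n4 _.
  move=> x y z w xe ye ze we.
  (* A vector orthogonal to eta is the value of an angular field, rescaled to
     absorb the factor L^2. *)
  pose field v := angular_field L (tchart_at u) ((L u ^- 2) *: v).
  have field_smooth v : smooth_pifield u (field v) by exact: smooth_angular_field.
  have phi_field v : phi L (field v) = field v by exact: phi_angular_field.
  have field_at v : bform G v (vec u) = 0 -> field v u = v.
    move=> ve; rewrite /field angular_field_at; last first.
      by rewrite -[LHS]/(bform _ _ _) bformZl ve mulr0.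
    by rewrite scalerA divff ?scale1r // expf_neq0.
  have hbar_field v v' : bform G v (vec u) = 0 -> bform G v' (vec u) = 0 ->
      hbar L (field v) (field v') u = bform G v v'.
    move=> ve ve'; rewrite /hbar /ell /g /eta !angular_field_orthogonal //.
    by rewrite !mulr0 subr0 !field_at.
  have := RoE u _ _ _ _ su (field_smooth x) (field_smooth y) (field_smooth z)
    (field_smooth w).
  by rewrite !phi_field R3 // !hbar_field // !field_at.
have ee : bform G (vec u) (vec u) = L u ^+ 2 by exact: metric_eta_eta.
have L20 : L u ^+ 2 != 0 by rewrite expf_neq0.
exists ((Ro u / 2 * L u ^+ 2 + bform B (vec u) (vec u)) / L u ^+ 2) => _ X Y Xs Ys.
have eta_smooth := smooth_eta su.
have ee0 : bform G (vec u) (vec u) != 0 by rewrite ee.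
rewrite R3 // /eta (R3_form_scalar symG ee0 Bperp) ee divfK //.
rewrite -[hbar L X Y u]/(bform G (X u) (Y u)
  - (L u)^-1 * bform G (X u) (vec u) * ((L u)^-1 * bform G (Y u) (vec u))).
by congr (_ * (_ - _)); field.
Qed.
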